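(* Let $(A,\Gamma)$ be a Hopf algebroid such that, through the left unit map $\eta_L:A\rightarrow\Gamma$, $\Gamma$ is a free $A$-module with a countable basis. Let $\Gamma^\vee$ be its dual algebra, with the compact-open topology. Then the assignment sending a right $\Gamma$-comodule $(M,\psi_M)$ to the discrete abelian group $M$ on which $D\in\Gamma^\vee$ acts by the composite $M\xrightarrow{\psi_M}M\otimes_{A,\eta_L}\Gamma\xrightarrow{\mathrm{id}_M\otimes D}M$ (and sending a comodule morphism to its underlying map) gives an equivalence of categories $$\mathrm{RCoMod}_\Gamma\xrightarrow{\sim}\mathrm{Mod}^d_{\Gamma^\vee},$$ where $\mathrm{RCoMod}_\Gamma$ is the category of right $\Gamma$-comodules and $\mathrm{Mod}^d_{\Gamma^\vee}$ is the category of discrete left $\Gamma^\vee$-modules with continuous $\Gamma^\vee$-actions.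
   Context: A Hopf algebroid is a pair of commutative rings $(A,\Gamma)$ with ring homomorphisms $\eta_L,\eta_R:A\to\Gamma$, $\epsilon:\Gamma\to A$, $\Delta:\Gamma\to\Gamma\otimes_{\eta_R,A,\eta_L}\Gamma$, $c:\Gamma\to\Gamma$ such that, naturally in commutative rings $R$, the sets $\mathrm{Hom}(A,R)$ and $\mathrm{Hom}(\Gamma,R)$ are the objects and morphisms of a groupoid, with $\eta_L,\eta_R$ inducing source and target, $\epsilon$ identities, $\Delta$ composition and $c$ inversion. In $\Gamma\otimes_{\eta_R,A,\eta_L}\Gamma$ the left factor is an $A$-module via $\eta_R$ and the right factor via $\eta_L$. A right $\Gamma$-comodule is an $A$-module $M$ with a map $\psi_M:M\to M\otimes_{A,\eta_L}\Gamma$ that is $A$-linear when the target is an $A$-module via $\eta_R$ on $\Gamma$, co-associative ($(\mathrm{id}_M\otimes\Delta)\psi_M=(\psi_M\otimes\mathrm{id}_\Gamma)\psi_M$) and co-unitary ($(\mathrm{id}_M\otimes\epsilon)\psi_M=\mathrm{id}_M$). Morphisms are $A$-linear maps compatible with the structure maps. The dual algebra is $\Gamma^\vee:=\mathrm{Hom}_{A,\eta_L}(\Gamma,A)$, the $A$-linear maps $\Gamma\to A$ with $\Gamma$ an $A$-module via $\eta_L$. For $D_1,D_2\in\Gamma^\vee$, the product $D_2\circ D_1$ is the composite $\Gamma\xrightarrow{\Delta}\Gamma\otimes_{\eta_R,A,\eta_L}\Gamma\xrightarrow{\mathrm{id}_\Gamma\otimes D_1}\Gamma\xrightarrow{D_2}A$,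 where $(\mathrm{id}_\Gamma\otimes D_1)(\gamma'\otimes\gamma)=\gamma'\eta_R(D_1(\gamma))$; the unit is $\epsilon$. $\Gamma^\vee$ carries the compact-open topology, with $\Gamma$ and $A$ discrete. An object of $\mathrm{Mod}^d_{\Gamma^\vee}$ is a discrete abelian group $M$ with a continuous ring homomorphism $\Gamma^\vee\to\mathrm{Hom}_{\mathbb Z}(M,M)$, where $\mathrm{Hom}_{\mathbb Z}(M,M)$ has the compact-open topology. Morphisms are homomorphisms of abelian groups commuting with the $\Gamma^\vee$-actions. *)

(* Defs.v *)
From HB Require Import structures.
From mathcomp Require Import all_boot all_algebra.
From mathcomp Require Import generic_quotient.
From mathcomp Require Import boolp classical_sets functions cardinality topology.

Set Implicit Arguments.
Unset Strict Implicit.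
Unset Printing Implicit Defensive.

Import GRing.Theory.

Local Open Scope ring_scope.
Local Open Scope quotient_scope.

Declare Scope hopf_scope.
Delimit Scope hopf_scope with hopf.
Local Open Scope hopf_scope.

Section Tensor.
Variables (A : comPzRingType) (M N : lmodType A).

(* The tensor product is the quotient of lists of pairs (formal sums of pure
   tensors) by the congruence generated by the bilinearity relations.  Formal
   opposites are not needed, since - (m (x) n) = (- m) (x) n. *)
Inductive tensor_eq : seq (M * N) -> seq (M * N) -> Prop :=
| tensor_eq_refl s : tensor_eq s s
| tensor_eq_sym s t : tensor_eq s t -> tensor_eq t s
| tensor_eq_trans s t u : tensor_eq s t -> tensor_eq t u -> tensor_eq s u
| tensor_eq_cat s s' t t' :
    tensor_eq s s' -> tensor_eq t t' -> tensor_eq (s ++ t) (s' ++ t')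
| tensor_eq_catC s t : tensor_eq (s ++ t) (t ++ s)
| tensor_eq_Dl m m' n : tensor_eq [:: (m + m', n)] [:: (m, n); (m', n)]
| tensor_eq_Dr m n n' : tensor_eq [:: (m, n + n')] [:: (m, n); (m, n')]
| tensor_eq_Z a m n : tensor_eq [:: (a *: m, n)] [:: (m, a *: n)]
| tensor_eq_0 : tensor_eq [:: (0, 0)] [::].

Definition tensor_eqb (s t : seq (M * N)) : bool := `[< tensor_eq s t >].

Lemma tensor_eqb_refl : reflexive tensor_eqb.
Proof. by move=> s; apply/asboolP/tensor_eq_refl. Qed.

Lemma tensor_eqb_sym : symmetric tensor_eqb.
Proof.
by move=> s t; apply/idP/idP => /asboolP/tensor_eq_sym/asboolP.
Qed.

Lemma tensor_eqb_trans : transitive tensor_eqb.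
Proof.
move=> t s u /asboolP st /asboolP tu; apply/asboolP.
exact: tensor_eq_trans st tu.
Qed.

Canonical tensor_equiv :=
  EquivRel tensor_eqb tensor_eqb_refl tensor_eqb_sym tensor_eqb_trans.

Definition tensor : Type := {eq_quot tensor_equiv}.
HB.instance Definition _ := Choice.on tensor.

Definition tsum (s : seq (M * N)) : tensor := \pi_({eq_quot tensor_equiv}) s.
Definition trepr (t : tensor) : seq (M * N) :=
  repr (t : {eq_quot tensor_equiv}).

Definition tpure (m : M) (n : N) : tensor := tsum [:: (m, n)].

Lemma treprK t : tsum (trepr t) = t.
Proof. exact: reprK. Qed.

Lemma tsumP s t : tensor_eq s t <-> tsum s = tsum t.
Proof.
split=> [st|/eqmodP/asboolP//].
by apply/eqmodP/asboolP.
Qed.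

Definition tensor_add (t u : tensor) := tsum (trepr t ++ trepr u).
Definition tensor_opp (t : tensor) :=
  tsum [seq (- p.1, p.2) | p <- trepr t].

Lemma tensor_addE s t : tensor_add (tsum s) (tsum t) = tsum (s ++ t).
Proof. by apply/tsumP; apply: tensor_eq_cat; apply/tsumP; rewrite treprK. Qed.

Lemma tensor_addA : associative tensor_add.
Proof.
move=> t u v; rewrite -(treprK t) -(treprK u) -(treprK v).
by rewrite !tensor_addE catA.
Qed.

Lemma tensor_addC : commutative tensor_add.
Proof. by move=> t u; apply/tsumP/tensor_eq_catC. Qed.

Lemma tensor_add0 : left_id (tsum [::]) tensor_add.
Proof. by move=> t; rewrite -{1}(treprK t) tensor_addE treprK. Qed.

Lemma tensor_eq_0l n : tensor_eq [:: (0, n)] [::].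
Proof.
apply: tensor_eq_trans tensor_eq_0.
by have := tensor_eq_Z 0 0 n; rewrite !scale0r.
Qed.

Lemma tensor_addN : left_inverse (tsum [::]) tensor_opp tensor_add.
Proof.
move=> t; rewrite -{2}(treprK t) /tensor_opp tensor_addE.
elim: (trepr t) => [//|[m n] s IHs] /=; rewrite -{}IHs.
rewrite -cat1s -[(m, n) :: s]cat1s catA -!tensor_addE.
rewrite [tensor_add (tsum [:: _]) _]tensor_addC -!tensor_addA; congr tensor_add.
rewrite tensor_addA tensor_addE /=.
have -> : tsum [:: (- m, n); (m, n)] = tsum [::].
  apply/tsumP; apply: tensor_eq_trans (tensor_eq_0l n).
  by apply: tensor_eq_sym; rewrite -{1}(addNr m); apply: tensor_eq_Dl.
exact: tensor_add0.
Qed.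

HB.instance Definition _ := GRing.isZmodule.Build tensor
  tensor_addA tensor_addC tensor_add0 tensor_addN.

Lemma tsum_cons p s : tsum (p :: s) = tpure p.1 p.2 + tsum s.
Proof. by case: p => m n; rewrite -cat1s -tensor_addE. Qed.

Lemma tensor_ind (P : tensor -> Prop) :
  P 0 -> (forall m n t, P t -> P (tpure m n + t)) -> forall t, P t.
Proof.
move=> P0 PD t; rewrite -(treprK t); elim: (trepr t) => [//|p s IHs].
by rewrite tsum_cons; apply: PD.
Qed.

Lemma tpureDl m m' n : tpure (m + m') n = tpure m n + tpure m' n.
Proof. by rewrite [RHS]tensor_addE; apply/tsumP/tensor_eq_Dl. Qed.

Lemma tpureDr m n n' : tpure m (n + n') = tpure m n + tpure m n'.
Proof. by rewrite [RHS]tensor_addE; apply/tsumP/tensor_eq_Dr. Qed.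

Lemma tpureZ a m n : tpure (a *: m) n = tpure m (a *: n).
Proof. exact/tsumP/tensor_eq_Z. Qed.

Definition balanced (P : zmodType) (f : M -> N -> P) : Prop :=
  [/\ forall m m' n, f (m + m') n = f m n + f m' n,
      forall m n n', f m (n + n') = f m n + f m n'
    & forall a m n, f (a *: m) n = f m (a *: n)].

Lemma tpure_balanced : balanced tpure.
Proof. by split; [apply: tpureDl|apply: tpureDr|apply: tpureZ]. Qed.

Section Lift.
Variables (P : zmodType) (f : M -> N -> P) (hf : balanced f).

Definition tlift of balanced f := fun t : tensor =>
  \sum_(p <- trepr t) f p.1 p.2.

Lemma tensor_eq_lift s t : tensor_eq s t ->
  \sum_(p <- s) f p.1 p.2 = \sum_(p <- t) f p.1 p.2.
Proof.
have [fDl fDr fZ] := hf.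
elim=> {s t} [//|s t _ -> //|s t u _ -> _ -> //|s s' t t' _ es _ et|s t||||].
- by rewrite !big_cat es et.
- by rewrite !big_cat /= addrC.
- by move=> m m' n; rewrite !big_cons !big_nil !addr0 fDl.
- by move=> m n n'; rewrite !big_cons !big_nil !addr0 fDr.
- by move=> a m n; rewrite !big_cons !big_nil !addr0 fZ.
by rewrite big_cons big_nil addr0; apply: (addrI (f 0 0)); rewrite -fDl !addr0.
Qed.

Lemma tlift_tsum s : tlift hf (tsum s) = \sum_(p <- s) f p.1 p.2.
Proof. by apply: tensor_eq_lift; apply/tsumP; rewrite treprK. Qed.

Lemma tlift_zmod : zmod_morphism (tlift hf).
Proof.
suff fD t u : tlift hf (t + u) = tlift hf t + tlift hf u.
  move=> t u; apply: (addIr (tlift hf u)).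
  by rewrite -fD !subrK.
rewrite -(treprK t) -(treprK u) [_ + _]tensor_addE !tlift_tsum.
exact: big_cat.
Qed.

HB.instance Definition _ :=
  GRing.isZmodMorphism.Build tensor P (tlift hf) tlift_zmod.

Lemma tliftE m n : tlift hf (tpure m n) = f m n.
Proof. by rewrite tlift_tsum big_cons big_nil addr0. Qed.

End Lift.

Lemma tensor_ext (P : zmodType) (f g : {additive tensor -> P}) :
  (forall m n, f (tpure m n) = g (tpure m n)) -> f =1 g.
Proof.
move=> fg; elim/tensor_ind => [|m n t IHt]; first by rewrite !raddf0.
by rewrite !raddfD fg IHt.
Qed.

Lemma tensor_scale_balanced a : balanced (fun m n => tpure (a *: m) n).
Proof.
split=> [m m' n|m n n'|b m n].
- by rewrite scalerDr tpureDl.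
- by rewrite tpureDr.
- by rewrite scalerA mulrC -scalerA tpureZ.
Qed.

Definition tensor_scale a := tlift (tensor_scale_balanced a).
HB.instance Definition _ a := GRing.Additive.copy (tensor_scale a)
  (tlift (tensor_scale_balanced a)).

Lemma tensor_scaleE a m n : tensor_scale a (tpure m n) = tpure (a *: m) n.
Proof. exact: tliftE. Qed.

Lemma tensor_scaleA a b t :
  tensor_scale a (tensor_scale b t) = tensor_scale (a * b) t.
Proof.
elim/tensor_ind: t => [|m n t IHt]; first by rewrite !raddf0.
by rewrite !raddfD /= {}IHt !tensor_scaleE scalerA.
Qed.

Lemma tensor_scale1 : left_id 1 tensor_scale.
Proof.
elim/tensor_ind => [|m n t IHt]; first by rewrite !raddf0.
by rewrite !raddfD /= {}IHt !tensor_scaleE scale1r.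
Qed.

Lemma tensor_scaleDr : right_distributive tensor_scale +%R.
Proof. by move=> a t u; rewrite raddfD. Qed.

Lemma tensor_scaleDl t : {morph tensor_scale^~ t : a b / a + b}.
Proof.
move=> a b; elim/tensor_ind: t => [|m n t IHt]; first by rewrite !raddf0 addr0.
by rewrite !raddfD /= {}IHt !tensor_scaleE scalerDl tpureDl addrACA.
Qed.

HB.instance Definition _ := GRing.Zmodule_isLmodule.Build A tensor
  tensor_scaleA tensor_scale1 tensor_scaleDr tensor_scaleDl.

Lemma scale_tpure a m n : a *: tpure m n = tpure (a *: m) n.
Proof. exact: tensor_scaleE. Qed.

End Tensor.

Notation "m ⊗ n" := (tpure m n) (at level 40, left associativity) : hopf_scope.

Section Pullback.
Variables (A B : comPzRingType) (f : {rmorphism A -> B}) (V : lmodType B).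

(* V as an A-module through f *)
Definition pullback of {rmorphism A -> B} : Type := V.
Local Notation fV := (pullback f).
HB.instance Definition _ := GRing.Zmodule.on fV.

Definition pullback_scale (a : A) (v : fV) : fV := f a *: (v : V).

Lemma pullback_scaleA a b v :
  pullback_scale a (pullback_scale b v) = pullback_scale (a * b) v.
Proof. by rewrite /pullback_scale scalerA rmorphM. Qed.

Lemma pullback_scale1 : left_id 1 pullback_scale.
Proof. by move=> v; rewrite /pullback_scale rmorph1 scale1r. Qed.

Lemma pullback_scaleDr : right_distributive pullback_scale +%R.
Proof. by move=> a u v; apply: (@scalerDr _ V). Qed.

Lemma pullback_scaleDl v : {morph pullback_scale^~ v : a b / a + b}.
Proof. by move=> a b; rewrite /pullback_scale rmorphD; apply: (@scalerDl _ V). Qed.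

HB.instance Definition _ := GRing.Zmodule_isLmodule.Build A fV
  pullback_scaleA pullback_scale1 pullback_scaleDr pullback_scaleDl.

Lemma pullbackZ a (v : fV) : a *: v = f a *: (v : V) :> V.
Proof. by []. Qed.

End Pullback.

Arguments pullback {A B} V f.

Section RingModule.
Variables (A B : comPzRingType) (f : {rmorphism A -> B}).

(* the ring B as an A-module through f *)
Definition rmod : lmodType A := pullback B^o f.

Lemma rmodZ a (b : rmod) : a *: b = f a * (b : B) :> B.
Proof. by []. Qed.

End RingModule.

Section Ext.
Variables (A B : comPzRingType) (f : {rmorphism A -> B}) (M : lmodType A).

(* M (x)_{A,f} B as a B-module through the right factor *)
Definition ext : Type := tensor M (rmod f).
Local Notation fM := ext.
HB.instance Definition _ := GRing.Zmodule.on fM.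

Definition ext_pure (m : M) (b : B) : fM := m ⊗ (b : rmod f).

Lemma ext_pure_balanced : @balanced _ M (rmod f) fM ext_pure.
Proof. exact: tpure_balanced. Qed.

Lemma ext_scale_balanced (b : B) :
  @balanced _ M (rmod f) fM (fun m b' => ext_pure m (b * b')).
Proof.
split=> [m m' b'|m b' b''|a m b'].
- exact: tpureDl.
- by rewrite mulrDr; apply: tpureDr.
- by rewrite rmodZ mulrCA; apply: tpureZ.
Qed.

Definition ext_scale (b : B) : fM -> fM := tlift (ext_scale_balanced b).
HB.instance Definition _ b := GRing.Additive.copy (ext_scale b)
  (tlift (ext_scale_balanced b)).

Lemma ext_scaleE b m b' : ext_scale b (ext_pure m b') = ext_pure m (b * b').
Proof. exact: tliftE. Qed.

Lemma ext_ind (P : fM -> Prop) :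
  P 0 -> (forall m b t, P t -> P (ext_pure m b + t)) -> forall t, P t.
Proof. exact: (@tensor_ind _ _ _ P). Qed.

Lemma ext_scaleA a b t : ext_scale a (ext_scale b t) = ext_scale (a * b) t.
Proof.
elim/ext_ind: t => [|m n t IHt]; first by rewrite !raddf0.
by rewrite !raddfD /= IHt !ext_scaleE mulrA.
Qed.

Lemma ext_scale1 : left_id 1 ext_scale.
Proof.
elim/ext_ind => [|m n t IHt]; first by rewrite !raddf0.
by rewrite !raddfD /= IHt !ext_scaleE mul1r.
Qed.

Lemma ext_scaleDr : right_distributive ext_scale +%R.
Proof. by move=> a t u; rewrite raddfD. Qed.

Lemma ext_scaleDl t : {morph ext_scale^~ t : a b / a + b}.
Proof.
move=> a b; elim/ext_ind: t => [|m n t IHt]; first by rewrite !raddf0 addr0.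
rewrite !raddfD /= IHt !ext_scaleE mulrDl addrACA; congr (_ + _).
exact: tpureDr.
Qed.

HB.instance Definition _ := GRing.Zmodule_isLmodule.Build B fM
  ext_scaleA ext_scale1 ext_scaleDr ext_scaleDl.

Lemma scale_ext_pure b m b' : b *: ext_pure m b' = ext_pure m (b * b').
Proof. exact: ext_scaleE. Qed.

End Ext.

Arguments ext_pure {A B} f {M} m b.

Section RTensor.
Variables (A B C : comPzRingType).
Variables (f : {rmorphism A -> B}) (g : {rmorphism A -> C}).

(* the commutative ring B (x)_{f,A,g} C *)
Definition rtensor : Type :=
  tensor (rmod f) (rmod g).
Local Notation T := rtensor.
HB.instance Definition _ := GRing.Zmodule.on T.

Definition rpure (b : B) (c : C) : T := (b : rmod f) ⊗ (c : rmod g).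

Lemma rpure_balanced : @balanced _ (rmod f) (rmod g) T rpure.
Proof. exact: tpure_balanced. Qed.

Lemma rtensor_ind (P : T -> Prop) :
  P 0 -> (forall b c t, P t -> P (rpure b c + t)) -> forall t, P t.
Proof. exact: (@tensor_ind _ _ _ P). Qed.

Lemma rmul1_balanced (b : B) (c : C) :
  @balanced _ (rmod f) (rmod g) T (fun b' c' => rpure (b * b') (c * c')).
Proof.
split=> [b' b'' c'|b' c' c''|a b' c'].
- by rewrite mulrDr; apply: tpureDl.
- by rewrite mulrDr; apply: tpureDr.
- by rewrite !rmodZ mulrCA [c * (_ * _)]mulrCA; apply: tpureZ.
Qed.

Definition rmul1 b c : T -> T := tlift (rmul1_balanced b c).
HB.instance Definition _ b c := GRing.Additive.copy (rmul1 b c)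
  (tlift (rmul1_balanced b c)).

Lemma rmul1E b c b' c' : rmul1 b c (rpure b' c') = rpure (b * b') (c * c').
Proof. exact: tliftE. Qed.

Lemma rmul_balanced (u : T) :
  @balanced _ (rmod f) (rmod g) T (fun b c => rmul1 b c u).
Proof.
split=> [b b' c|b c c'|a b c]; elim/rtensor_ind: u => [|b0 c0 u IHu].
all: rewrite ?raddf0 ?addr0 ?raddfD /= ?{}IHu ?rmul1E //.
- by rewrite addrACA; congr (_ + _); rewrite mulrDl; apply: tpureDl.
- by rewrite addrACA; congr (_ + _); rewrite mulrDl; apply: tpureDr.
- by congr (_ + _); rewrite !rmodZ -!mulrA; apply: tpureZ.
Qed.

Definition rmul (t u : T) : T := tlift (rmul_balanced u) t.

Lemma rmulDl : left_distributive rmul +%R.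
Proof. by move=> t t' u; apply: raddfD. Qed.

Lemma rmul_pure b c u : rmul (rpure b c) u = rmul1 b c u.
Proof. exact: tliftE. Qed.

Lemma rmul0l u : rmul 0 u = 0.
Proof. exact: raddf0. Qed.

Lemma rmul_pure2 b c b' c' :
  rmul (rpure b c) (rpure b' c') = rpure (b * b') (c * c').
Proof. by rewrite rmul_pure rmul1E. Qed.

Lemma rmulC : commutative rmul.
Proof.
have mul0 u : rmul u 0 = 0.
  elim/rtensor_ind: u => [|b c u IHu]; first exact: rmul0l.
  by rewrite rmulDl IHu rmul_pure raddf0 addr0.
have mulD t u v : rmul t (u + v) = rmul t u + rmul t v.
  elim/rtensor_ind: t => [|b c t IHt]; first by rewrite !rmul0l addr0.
  by rewrite !rmulDl IHt !rmul_pure raddfD addrACA.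
move=> t u; elim/rtensor_ind: t => [|b c t IHt]; first by rewrite rmul0l mul0.
rewrite rmulDl mulD IHt; congr (_ + _).
elim/rtensor_ind: u {IHt} => [|b' c' u IHu]; first by rewrite rmul0l mul0.
by rewrite rmulDl mulD IHu !rmul_pure2 mulrC [c * _]mulrC.
Qed.

Lemma rmulDr : right_distributive rmul +%R.
Proof. by move=> t u v; rewrite rmulC rmulDl ![rmul _ t]rmulC. Qed.

Lemma rmul0r u : rmul u 0 = 0.
Proof. by rewrite rmulC rmul0l. Qed.

Lemma rmulA : associative rmul.
Proof.
move=> t u v; elim/rtensor_ind: t => [|b c t IHt]; first by rewrite !rmul0l.
rewrite !rmulDl IHt; congr (_ + _).
elim/rtensor_ind: u {IHt} => [|b' c' u IHu]; first by rewrite ?(rmul0l, rmul0r).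
rewrite rmulDl !rmulDr rmulDl IHu; congr (_ + _).
elim/rtensor_ind: v {IHu} => [|b'' c'' v IHv]; first by rewrite !rmul0r.
by rewrite !rmulDr IHv !rmul_pure2 !mulrA.
Qed.

Lemma rmul1l : left_id (rpure 1 1) rmul.
Proof.
elim/rtensor_ind => [|b c t IHt]; first by rewrite rmul0r.
by rewrite rmulDr IHt rmul_pure2 !mul1r.
Qed.

HB.instance Definition _ := GRing.Zmodule_isComPzRing.Build T
  rmulA rmulC rmul1l rmulDl.

Lemma rpureM b c b' c' : rpure b c * rpure b' c' = rpure (b * b') (c * c').
Proof. exact: rmul_pure2. Qed.

Lemma rpureDl b b' c : rpure (b + b') c = rpure b c + rpure b' c.
Proof. exact: tpureDl. Qed.

Lemma rpureDr b c c' : rpure b (c + c') = rpure b c + rpure b c'.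
Proof. exact: tpureDr. Qed.

Lemma rpureZ a b c : rpure (f a * b) c = rpure b (g a * c).
Proof. exact: tpureZ. Qed.

Definition rinl (b : B) : T := rpure b 1.
Definition rinr (c : C) : T := rpure 1 c.

Lemma rinl_zmod : zmod_morphism rinl.
Proof.
by move=> b b'; apply: (addIr (rinl b')); rewrite subrK -rpureDl subrK.
Qed.
HB.instance Definition _ := GRing.isZmodMorphism.Build B T rinl rinl_zmod.

Lemma rinl_monoid : monoid_morphism rinl.
Proof. by split=> // b b'; rewrite rpureM mul1r. Qed.
HB.instance Definition _ := GRing.isMonoidMorphism.Build B T rinl rinl_monoid.

Lemma rinr_zmod : zmod_morphism rinr.
Proof.
by move=> b b'; apply: (addIr (rinr b')); rewrite subrK -rpureDr subrK.
Qed.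
HB.instance Definition _ := GRing.isZmodMorphism.Build C T rinr rinr_zmod.

Lemma rinr_monoid : monoid_morphism rinr.
Proof. by split=> // b b'; rewrite rpureM mul1r. Qed.
HB.instance Definition _ := GRing.isMonoidMorphism.Build C T rinr rinr_monoid.

Lemma rpureE b c : rpure b c = rinl b * rinr c.
Proof. by rewrite rpureM mul1r mulr1. Qed.

Lemma rin_comm a : rinl (f a) = rinr (g a).
Proof. by rewrite /rinl -[f a]mulr1 rpureZ mulr1. Qed.

Section Copair.
Variables (R : comPzRingType) (u : {rmorphism B -> R}) (v : {rmorphism C -> R}).
Hypothesis uv : u \o f = v \o g :> {rmorphism A -> R}.

Lemma copair_balanced :
  @balanced _ (rmod f) (rmod g) R (fun b c => u b * v c).
Proof.
split=> [b b' c|b c c'|a b c]; rewrite ?rmodZ ?rmorphD ?mulrDl ?mulrDr //.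
rewrite !rmorphM mulrCA mulrA; congr (_ * _ * _).
exact: (congr1 (fun h : {rmorphism A -> R} => h a) uv).
Qed.

(* the morphism B (x)_A C -> R induced by u and v *)
Definition copair : T -> R := tlift copair_balanced.
HB.instance Definition _ := GRing.Additive.copy copair (tlift copair_balanced).

Lemma copairE b c : copair (rpure b c) = u b * v c.
Proof. exact: tliftE. Qed.

Lemma copair_monoid : monoid_morphism copair.
Proof.
split=> [|t t']; first by rewrite copairE !rmorph1 mulr1.
elim/rtensor_ind: t => [|b c t IHt]; first by rewrite !(mul0r, raddf0).
rewrite mulrDl !raddfD /= IHt mulrDl; congr (_ + _).
elim/rtensor_ind: t' {IHt} => [|b' c' t' IHt']; first by rewrite !(mulr0, raddf0).
rewrite mulrDr !raddfD /= IHt' mulrDr; congr (_ + _).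
by rewrite rpureM !copairE !rmorphM mulrACA.
Qed.
HB.instance Definition _ := GRing.isMonoidMorphism.Build T R copair
  copair_monoid.

End Copair.

End RTensor.

Arguments rpure {A B C} f g b c.
Arguments rinl {A B C} f g b.
Arguments rinr {A B C} f g c.

Lemma rmorphP (R S : pzSemiRingType) (f g : {rmorphism R -> S}) :
  f =1 g -> f = g.
Proof.
case: f g => [f [[f0] [f1]]] [g [[g0] [g1]]] /= /funext fg.
move: g0 g1; rewrite -fg => g0 g1.
by rewrite (Prop_irrelevance f0 g0) (Prop_irrelevance f1 g1).
Qed.

Lemma linearP_eq (R : pzRingType) (U : lmodType R) (V : zmodType)
    (s : R -> V -> V) (f g : {linear U -> V | s}) : f =1 g -> f = g.
Proof.
case: f g => [f [[f0] [f1]]] [g [[g0] [g1]]] /= /funext fg.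
move: g0 g1; rewrite -fg => g0 g1.
by rewrite (Prop_irrelevance f0 g0) (Prop_irrelevance f1 g1).
Qed.

Lemma additiveP_eq (U V : zmodType) (f g : {additive U -> V}) :
  f =1 g -> f = g.
Proof.
case: f g => [f [[f0]]] [g [[g0]]] /= /funext fg.
by move: g0; rewrite -fg => g0; rewrite (Prop_irrelevance f0 g0).
Qed.

Section ExtMap.
Variables (A B : comPzRingType) (f : {rmorphism A -> B}).

Section Def.
Variables (M N : lmodType A) (h : {linear M -> N}).

Lemma ext_map_balanced :
  @balanced _ M (rmod f) (ext f N) (fun m b => ext_pure f (h m) b).
Proof.
have [pDl pDr pZ] := ext_pure_balanced f N.
by split=> [m m' b|m b b'|a m b]; rewrite ?raddfD ?linearZ ?pDl ?pDr ?pZ.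
Qed.

(* h (x) id_B *)
Definition ext_map : ext f M -> ext f N := tlift ext_map_balanced.
HB.instance Definition _ := GRing.Additive.copy ext_map
  (tlift ext_map_balanced).

Lemma ext_mapE m b : ext_map (ext_pure f m b) = ext_pure f (h m) b.
Proof. exact: tliftE. Qed.

End Def.

Lemma ext_map_id (M : lmodType A) (t : ext f M) : ext_map (idfun : {linear M -> M}) t = t.
Proof.
elim/ext_ind: t => [|m b t IHt]; first exact: raddf0.
by rewrite raddfD /= IHt ext_mapE.
Qed.

Lemma ext_map_comp (M N P : lmodType A) (h : {linear M -> N})
    (k : {linear N -> P}) t :
  ext_map (k \o h : {linear M -> P}) t = ext_map k (ext_map h t).
Proof.
elim/ext_ind: t => [|m b t IHt]; first by rewrite !raddf0.
by rewrite !raddfD /= IHt !ext_mapE.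
Qed.

End ExtMap.

Arguments ext_map {A B} f {M N} h.

Section ExtAssoc.
Variables (A B C : comPzRingType) (M : lmodType A).
Variables (f g : {rmorphism A -> B}) (h : {rmorphism A -> C}).

Local Notation fl := (rinl g h \o f : {rmorphism A -> rtensor g h}).

Lemma ext_assoc1_balanced (c : C) : @balanced _ M (rmod f) (ext fl M)
  (fun m b => ext_pure fl m (rpure g h b c)).
Proof.
have [pDl pDr pZ] := ext_pure_balanced fl M.
split=> [m m' b|m b b'|a m b].
- exact: pDl.
- by rewrite rpureDl; apply: pDr.
- rewrite pZ rmodZ; congr ext_pure.
  by rewrite rmodZ rpureM mul1r.
Qed.

Definition ext_assoc1 (c : C) : ext f M -> ext fl M :=
  tlift (ext_assoc1_balanced c).
HB.instance Definition _ c := GRing.Additive.copy (ext_assoc1 c)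
  (tlift (ext_assoc1_balanced c)).

Lemma ext_assoc1E c m b :
  ext_assoc1 c (ext_pure f m b) = ext_pure fl m (rpure g h b c).
Proof. exact: tliftE. Qed.

Lemma ext_assoc_balanced :
  @balanced _ (pullback (ext f M) g) (rmod h) (ext fl M)
    (fun t c => ext_assoc1 c t).
Proof.
have [pDl pDr pZ] := ext_pure_balanced fl M.
split=> [t t' c|t c c'|a t c]; first exact: raddfD.
  elim/ext_ind: t => [|m b t IHt]; first by rewrite !raddf0 addr0.
  rewrite !raddfD /= IHt !ext_assoc1E addrACA; congr (_ + _).
  by rewrite rpureDr pDr.
rewrite pullbackZ; elim/ext_ind: t => [|m b t IHt].
  by rewrite scaler0 !raddf0.
rewrite scalerDr !raddfD /= IHt scale_ext_pure !ext_assoc1E; congr (_ + _).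
by rewrite rmodZ rpureZ.
Qed.

(* the canonical map (M (x)_{A,f} B) (x)_{g,A,h} C ->
   M (x)_{A,f} (B (x)_{g,A,h} C) *)
Definition ext_assoc : ext h (pullback (ext f M) g) -> ext fl M :=
  tlift ext_assoc_balanced.
HB.instance Definition _ := GRing.Additive.copy ext_assoc
  (tlift ext_assoc_balanced).

Lemma ext_assocE m b c :
  ext_assoc (ext_pure h (ext_pure f m b : pullback (ext f M) g) c) =
  ext_pure fl m (rpure g h b c).
Proof. by rewrite [LHS]tliftE ext_assoc1E. Qed.

Lemma ext_assocE1 t c :
  ext_assoc (ext_pure h (t : pullback (ext f M) g) c) = ext_assoc1 c t.
Proof. exact: tliftE. Qed.

End ExtAssoc.

(* comp f g is "f, then g": it is defined when the target of f is the source
   of g *)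
Record is_groupoid (Ob Mor : Type) (src tgt : Mor -> Ob) (idt : Ob -> Mor)
    (comp : forall f g : Mor, tgt f = src g -> Mor) (inv : Mor -> Mor) : Prop :=
  IsGroupoid {
  groupoid_src_id : forall x, src (idt x) = x;
  groupoid_tgt_id : forall x, tgt (idt x) = x;
  groupoid_src_comp : forall f g fg, src (comp f g fg) = src f;
  groupoid_tgt_comp : forall f g fg, tgt (comp f g fg) = tgt g;
  groupoid_src_inv : forall f, src (inv f) = tgt f;
  groupoid_tgt_inv : forall f, tgt (inv f) = src f;
  groupoid_id_comp : forall f H, comp (idt (src f)) f H = f;
  groupoid_comp_id : forall f H, comp f (idt (tgt f)) H = f;
  groupoid_compA : forall f g h fg fg_h gh f_gh,
    comp (comp f g fg) h fg_h = comp f (comp g h gh) f_gh;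
  groupoid_inv_comp : forall f H, comp (inv f) f H = idt (tgt f);
  groupoid_comp_inv : forall f H, comp f (inv f) H = idt (src f)
}.

Arguments is_groupoid {Ob Mor} src tgt idt comp inv.

Section FunctorOfPoints.
Variables (A Gam : comPzRingType) (etaL etaR : {rmorphism A -> Gam}).
Variables (eps : {rmorphism Gam -> A}).
Variables (Delta : {rmorphism Gam -> rtensor etaR etaL}).
Variables (c : {rmorphism Gam -> Gam}) (R : comPzRingType).

Definition pt_src (f : {rmorphism Gam -> R}) : {rmorphism A -> R} := f \o etaL.
Definition pt_tgt (f : {rmorphism Gam -> R}) : {rmorphism A -> R} := f \o etaR.
Definition pt_id (x : {rmorphism A -> R}) : {rmorphism Gam -> R} := x \o eps.
Definition pt_comp (f g : {rmorphism Gam -> R}) (fg : pt_tgt f = pt_src g) :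
  {rmorphism Gam -> R} := copair fg \o Delta.
Definition pt_inv (f : {rmorphism Gam -> R}) : {rmorphism Gam -> R} := f \o c.

End FunctorOfPoints.

(* Every groupoid operation on Hom(A, R) and Hom(Gamma, R) is precomposition
   with a ring morphism, hence is natural in R. *)
Record hopf_algebroid : Type := HopfAlgebroid {
  base : comPzRingType;
  total : comPzRingType;
  etaL : {rmorphism base -> total};
  etaR : {rmorphism base -> total};
  counit : {rmorphism total -> base};
  comul : {rmorphism total -> rtensor etaR etaL};
  antipode : {rmorphism total -> total};
  hopf_groupoid : forall R : comPzRingType,
    is_groupoid (@pt_src _ _ etaL R) (@pt_tgt _ _ etaR R) (@pt_id _ _ counit R)
      (@pt_comp _ _ etaL etaR comul R) (@pt_inv _ antipode R)
}.

Section HopfTheory.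
Variable G : hopf_algebroid.
Local Notation A := (base G).
Local Notation Gam := (total G).
Local Notation GG := (rtensor (etaR G) (etaL G)).

Lemma counit_etaL a : counit G (etaL G a) = a.
Proof.
have /(congr1 (fun h : {rmorphism A -> A} => h a)) :=
  groupoid_src_id (hopf_groupoid G A) (idfun : {rmorphism A -> A}).
exact.
Qed.

Lemma counit_etaR a : counit G (etaR G a) = a.
Proof.
have /(congr1 (fun h : {rmorphism A -> A} => h a)) :=
  groupoid_tgt_id (hopf_groupoid G A) (idfun : {rmorphism A -> A}).
exact.
Qed.

Lemma rin_comp : pt_tgt (etaR G) (rinl (etaR G) (etaL G)) =
                 pt_src (etaL G) (rinr (etaR G) (etaL G)).
Proof. by apply: rmorphP => a; apply: rin_comm. Qed.

Lemma copair_rin t : copair rin_comp t = t.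
Proof.
elim/rtensor_ind: t => [|b c t IHt]; first exact: raddf0.
by rewrite raddfD /= IHt copairE /= -rpureE.
Qed.

Lemma comul_etaL a : comul G (etaL G a) = rinl (etaR G) (etaL G) (etaL G a).
Proof.
have /(congr1 (fun h : {rmorphism A -> GG} => h a)) :=
  groupoid_src_comp (hopf_groupoid G GG) rin_comp.
by rewrite /= copair_rin.
Qed.

Lemma comul_etaR a : comul G (etaR G a) = rinr (etaR G) (etaL G) (etaR G a).
Proof.
have /(congr1 (fun h : {rmorphism A -> GG} => h a)) :=
  groupoid_tgt_comp (hopf_groupoid G GG) rin_comp.
by rewrite /= copair_rin.
Qed.

End HopfTheory.

Section Comodule.
Variable G : hopf_algebroid.
Local Notation A := (base G).
Local Notation Gam := (total G).
Local Notation eL := (etaL G).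
Local Notation eR := (etaR G).

(* the left unit A -> Gamma -> Gamma (x)_{eR,A,eL} Gamma *)
Definition eLL : {rmorphism A -> rtensor eR eL} := rinl eR eL \o eL.

Section IdComul.
Variable M : lmodType A.

Lemma id_comul_balanced : @balanced _ M (rmod eL) (ext eLL M)
  (fun m x => ext_pure eLL m (comul G x)).
Proof.
have [pDl pDr pZ] := ext_pure_balanced eLL M.
split=> [m m' b|m b b'|a m b].
- exact: pDl.
- by rewrite raddfD; apply: pDr.
- by rewrite pZ !rmodZ rmorphM comul_etaL.
Qed.

(* id_M (x) Delta *)
Definition id_comul : ext eL M -> ext eLL M := tlift id_comul_balanced.
HB.instance Definition _ := GRing.Additive.copy id_comul
  (tlift id_comul_balanced).

Lemma id_comulE m x : id_comul (ext_pure eL m x) = ext_pure eLL m (comul G x).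
Proof. exact: tliftE. Qed.

End IdComul.

(* the dual algebra Hom_{A,etaL}(Gamma, A) *)
Definition dual_alg : Type := {scalar rmod eL}.
HB.instance Definition _ := gen_eqMixin dual_alg.
HB.instance Definition _ := gen_choiceMixin dual_alg.

Definition counit_mod : rmod eL -> A := counit G.

Lemma counit_mod_scalar : scalar counit_mod.
Proof.
by move=> a x y; rewrite /counit_mod rmorphD rmodZ rmorphM counit_etaL.
Qed.
HB.instance Definition _ :=
  GRing.isLinear.Build A (rmod eL) A *%R counit_mod counit_mod_scalar.

Definition dual_one : dual_alg := counit_mod : {scalar rmod eL}.

Section IdDual.
Variables (M : lmodType A) (D : dual_alg).

Lemma id_dual_balanced : @balanced _ M (rmod eL) M (fun m x => D x *: m).
Proof.
split=> [m m' b|m b b'|a m b].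
- exact: scalerDr.
- by rewrite raddfD scalerDl.
- by rewrite scalarZ scalerA mulrC.
Qed.

(* id_M (x) D, composed with M (x)_A A = M *)
Definition id_dual : ext eL M -> M := tlift id_dual_balanced.
HB.instance Definition _ := GRing.Additive.copy id_dual
  (tlift id_dual_balanced).

Lemma id_dualE m x : id_dual (ext_pure eL m x) = D x *: m.
Proof. exact: tliftE. Qed.

End IdDual.

Definition coassociative (M : lmodType A)
    (psi : {linear M -> pullback (ext eL M) eR}) : Prop :=
  forall m, id_comul (psi m) = ext_assoc (ext_map eL psi (psi m)).

Definition counitary (M : lmodType A)
    (psi : {linear M -> pullback (ext eL M) eR}) : Prop :=
  forall m, id_dual dual_one (psi m) = m.

Record rcomod : Type := RComod {
  rcomod_carrier :> lmodType A;
  coact : {linear rcomod_carrier -> pullback (ext eL rcomod_carrier) eR};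
  coactA : coassociative coact;
  coact1 : counitary coact
}.

Definition comod_morphism (M N : rcomod) (f : {linear M -> N}) : Prop :=
  forall m, ext_map eL f (coact M m) = coact N (f m).

Definition comod_hom (M N : rcomod) : Type :=
  {f : {linear M -> N} | comod_morphism f}.

End Comodule.

Section DualRing.
Variable G : hopf_algebroid.
Local Notation A := (base G).
Local Notation Gam := (total G).
Local Notation eL := (etaL G).
Local Notation eR := (etaR G).
Local Notation GG := (rtensor eR eL).
Local Notation eLL := (eLL G).
Local Notation dual := (dual_alg G).
Implicit Types D : dual.

Lemma dualP D D' : (forall x, D x = D' x) -> D = D'.
Proof. exact: linearP_eq. Qed.

Lemma dualZ D a (x : Gam) : D (eL a * x) = a * D x.
Proof. exact: (scalarZ D). Qed.

Definition dual_add_fun D D' (x : rmod eL) : A := D x + D' x.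
Lemma dual_add_scalar D D' : scalar (dual_add_fun D D').
Proof.
by move=> a x y; rewrite /dual_add_fun !scalarP mulrDr addrACA.
Qed.
HB.instance Definition _ D D' := GRing.isLinear.Build A (rmod eL) A *%R
  (dual_add_fun D D') (dual_add_scalar D D').
Definition dual_add D D' : dual := dual_add_fun D D' : {scalar rmod eL}.

Definition dual_opp_fun D (x : rmod eL) : A := - D x.
Lemma dual_opp_scalar D : scalar (dual_opp_fun D).
Proof.
by move=> a x y; rewrite /dual_opp_fun scalarP opprD mulrN.
Qed.
HB.instance Definition _ D := GRing.isLinear.Build A (rmod eL) A *%R
  (dual_opp_fun D) (dual_opp_scalar D).
Definition dual_opp D : dual := dual_opp_fun D : {scalar rmod eL}.

Definition dual_zero_fun (x : rmod eL) : A := 0.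
Lemma dual_zero_scalar : scalar dual_zero_fun.
Proof. by move=> a x y; rewrite /dual_zero_fun mulr0 addr0. Qed.
HB.instance Definition _ := GRing.isLinear.Build A (rmod eL) A *%R
  dual_zero_fun dual_zero_scalar.
Definition dual_zero : dual := dual_zero_fun : {scalar rmod eL}.

Lemma dual_addA : associative dual_add.
Proof. by move=> D1 D2 D3; apply: dualP => x; apply: addrA. Qed.
Lemma dual_addC : commutative dual_add.
Proof. by move=> D1 D2; apply: dualP => x; apply: addrC. Qed.
Lemma dual_add0 : left_id dual_zero dual_add.
Proof. by move=> D; apply: dualP => x; apply: add0r. Qed.
Lemma dual_addN : left_inverse dual_zero dual_opp dual_add.
Proof. by move=> D; apply: dualP => x; apply: addNr. Qed.
HB.instance Definition _ := GRing.isZmodule.Build dual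
  dual_addA dual_addC dual_add0 dual_addN.

Section IdTens.
Variable D : dual.

Lemma idtens_balanced :
  @balanced _ (rmod eR) (rmod eL) Gam (fun x y => x * eR (D y)).
Proof.
split=> [x x' y|x y y'|a x y].
- exact: mulrDl.
- by rewrite raddfD /= rmorphD mulrDr.
- by rewrite scalarZ rmodZ rmorphM mulrCA mulrA.
Qed.

(* id_Gamma (x) D *)
Definition idtens : GG -> Gam := tlift idtens_balanced.
HB.instance Definition _ := GRing.Additive.copy idtens (tlift idtens_balanced).

Lemma idtensE x y : idtens (rpure eR eL x y) = x * eR (D y).
Proof. exact: tliftE. Qed.

Lemma idtens_rinl x t : idtens (rinl eR eL x * t) = x * idtens t.
Proof.
elim/rtensor_ind: t => [|b c t IHt]; first by rewrite mulr0 !raddf0 mulr0.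
rewrite mulrDr !raddfD /= IHt mulrDr; congr (_ + _).
by rewrite rpureM mul1r !idtensE mulrA.
Qed.

End IdTens.

(* D2 o D1 is the composite D2 (id_Gamma (x) D1) Delta *)
Definition dual_mul_fun D2 D1 (x : rmod eL) : A := D2 (idtens D1 (comul G x)).

Lemma dual_mul_scalar D2 D1 : scalar (dual_mul_fun D2 D1).
Proof.
move=> a x y; rewrite /dual_mul_fun !raddfD /= rmodZ rmorphM comul_etaL.
by rewrite idtens_rinl dualZ.
Qed.
HB.instance Definition _ D2 D1 := GRing.isLinear.Build A (rmod eL) A *%R
  (dual_mul_fun D2 D1) (dual_mul_scalar D2 D1).
Definition dual_mul D2 D1 : dual := dual_mul_fun D2 D1 : {scalar rmod eL}.

Lemma id_dual_mul (M : lmodType A) (psi : {linear M -> pullback (ext eL M) eR})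
    D2 D1 m : coassociative psi ->
  id_dual (dual_mul D2 D1) (psi m) = id_dual D2 (psi (id_dual D1 (psi m))).
Proof.
move=> psiA.
have hPhi : @balanced _ M (rmod eLL) M (fun m t => D2 (idtens D1 t) *: m).
  split=> [m1 m2 t|m1 t t'|a m1 t].
  - exact: scalerDr.
  - by rewrite !raddfD scalerDl.
  - by rewrite rmodZ idtens_rinl dualZ scalerA mulrC.
pose Phi : {additive ext eLL M -> M} := tlift hPhi.
have PhiE m1 t : Phi (ext_pure eLL m1 t) = D2 (idtens D1 t) *: m1.
  exact: tliftE.
have PhiL t : Phi (id_comul t) = id_dual (dual_mul D2 D1) t.
  elim/ext_ind: t => [|m1 x t IHt]; first by rewrite !raddf0.
  by rewrite !raddfD /= IHt id_comulE PhiE id_dualE.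
have Phi1 t x : Phi (ext_assoc1 eR eL x t) = id_dual D2 (eR (D1 x) *: t).
  elim/ext_ind: t => [|m1 y t IHt]; first by rewrite scaler0 !raddf0.
  rewrite scalerDr !raddfD /= IHt scale_ext_pure ext_assoc1E PhiE id_dualE.
  by rewrite idtensE mulrC.
have PhiR t : Phi (ext_assoc (ext_map eL psi t)) =
    id_dual D2 (psi (id_dual D1 t)).
  elim/ext_ind: t => [|m1 x t IHt]; first by rewrite !raddf0.
  rewrite !raddfD /= IHt ext_mapE ext_assocE1 Phi1 id_dualE.
  by rewrite linearZ.
by rewrite -PhiL psiA PhiR.
Qed.

Section Regular.

(* Gamma as a right comodule over itself *)
Definition comul_mod : rmod eR -> pullback (ext eL (rmod eR)) eR := comul G.

Lemma scale_ext_rmod (b : Gam) (t : ext eL (rmod eR)) :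
  b *: t = rinr eR eL b * (t : GG) :> GG.
Proof.
elim/ext_ind: t => [|x y t IHt]; first by rewrite scaler0 mulr0.
rewrite scalerDr [RHS]mulrDr -IHt scale_ext_pure.
by rewrite [_ * (ext_pure eL x y : GG)]rpureM mul1r.
Qed.

Lemma comul_mod_linear : linear comul_mod.
Proof.
move=> a x y; rewrite /comul_mod rmodZ rmorphD rmorphM comul_etaR.
by rewrite pullbackZ scale_ext_rmod.
Qed.
HB.instance Definition _ := GRing.isLinear.Build A (rmod eR)
  (pullback (ext eL (rmod eR)) eR) *:%R comul_mod comul_mod_linear.

Lemma id_dual_comul D x : id_dual D (comul_mod x) = idtens D (comul G x).
Proof.
rewrite /comul_mod; elim/rtensor_ind: (comul G x) => [|b c t IHt].
  by rewrite !raddf0.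
rewrite [RHS]raddfD /= -IHt; apply: etrans (raddfD _ _ _) _; congr (_ + _).
by rewrite idtensE mulrC -rmodZ; apply: (@id_dualE G (rmod eR)).
Qed.

Lemma comul_modA : @coassociative G (rmod eR) comul_mod.
Proof.
pose T := rtensor eR eLL.
pose f : {rmorphism Gam -> T} := rinl eR eLL.
pose k : {rmorphism GG -> T} := rinr eR eLL.
pose g : {rmorphism Gam -> T} := k \o rinl eR eL.
pose h : {rmorphism Gam -> T} := k \o rinr eR eL.
have fg : pt_tgt eR f = pt_src eL g by apply: rmorphP => a; apply: rin_comm.
have gh : pt_tgt eR g = pt_src eL h.
  by apply: rmorphP => a; congr (rpure _ _ 1 _); apply: rin_comm.
have P := hopf_groupoid G T.
have fg_h : pt_tgt eR (pt_comp (comul G) fg) = pt_src eL h.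
  by rewrite (groupoid_tgt_comp P).
have f_gh : pt_tgt eR f = pt_src eL (pt_comp (comul G) gh).
  by rewrite (groupoid_src_comp P).
have compA := @groupoid_compA _ _ _ _ _ _ _ P f g h fg fg_h gh f_gh.
have ghE s : copair gh s = k s.
  elim/rtensor_ind: s => [|b c s IHs]; first by rewrite !raddf0.
  by rewrite !raddfD /= IHs copairE rpureE rmorphM.
have lhsE (t : ext eL (rmod eR)) : copair f_gh t = id_comul t.
  elim/ext_ind: t => [|b c t IHt]; first by rewrite [LHS]raddf0 raddf0.
  rewrite [RHS]raddfD /= -IHt [LHS]raddfD; congr (_ + _).
  by rewrite [LHS]copairE id_comulE /= ghE -rpureE.
have fgE c s : copair fg s * h c = ext_assoc1 eR eL c (s : ext eL (rmod eR)).
  elim/rtensor_ind: s => [|x y s IHs].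
    by rewrite raddf0 mul0r; symmetry; apply: raddf0.
  rewrite raddfD /= mulrDl IHs; symmetry; apply: etrans (raddfD _ _ _) _.
  congr (_ + _); rewrite [LHS]ext_assoc1E copairE.
  have ghc : g y * h c = k (rpure eR eL y c) by rewrite rpureE rmorphM.
  by rewrite -mulrA ghc -rpureE.
have rhsE (t : ext eL (rmod eR)) : copair fg_h t =
    ext_assoc (ext_map eL (comul_mod : {linear _ -> _}) t).
  elim/ext_ind: t => [|b c t IHt]; first by rewrite [LHS]raddf0 !raddf0.
  rewrite [ext_map _ _ _]raddfD [RHS]raddfD /= -IHt [LHS]raddfD; congr (_ + _).
  by rewrite [LHS]copairE ext_mapE ext_assocE1 -fgE.
move=> x; rewrite -lhsE -rhsE.
by have /(congr1 (fun u : {rmorphism Gam -> T} => u x)) := compA.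
Qed.

End Regular.

Lemma dual_mulA : associative dual_mul.
Proof.
move=> D3 D2 D1; apply: dualP => x.
rewrite /= /dual_mul /dual_mul_fun /= -id_dual_comul.
by rewrite (id_dual_mul _ _ _ comul_modA) !id_dual_comul.
Qed.

Lemma dual_mul1 : right_id (dual_one G) dual_mul.
Proof.
move=> D; apply: dualP => x; congr (D _).
have H : pt_tgt eR (idfun : {rmorphism Gam -> Gam}) =
    pt_src eL (pt_id (counit G) (pt_tgt eR (idfun : {rmorphism Gam -> Gam}))).
  by apply: rmorphP => a; rewrite /= counit_etaL.
have Hx : copair H (comul G x) = x.
  exact: (congr1 (fun u : {rmorphism Gam -> Gam} => u x)
    (groupoid_comp_id (hopf_groupoid G Gam) H)).
rewrite -[RHS]Hx.
elim/rtensor_ind: (comul G x) => [|b c t IHt]; first by rewrite !raddf0.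
by rewrite !raddfD /= IHt idtensE copairE.
Qed.

Lemma dual_1mul : left_id (dual_one G) dual_mul.
Proof.
move=> D; apply: dualP => x.
pose idG : {rmorphism Gam -> Gam} := idfun.
have H : pt_tgt eR (pt_id (counit G) (pt_src eL idG)) = pt_src eL idG.
  by apply: rmorphP => a; rewrite /= counit_etaR.
have Hx : copair H (comul G x) = x.
  exact: (congr1 (fun u : {rmorphism Gam -> Gam} => u x)
    (groupoid_id_comp (hopf_groupoid G Gam) H)).
have E t : counit G (idtens D t) = D (copair H t).
  elim/rtensor_ind: t => [|b c t IHt]; first by rewrite !raddf0.
  rewrite !raddfD /= IHt idtensE copairE /=; congr (_ + _).
  by rewrite rmorphM counit_etaR dualZ.
by rewrite -[in RHS]Hx -E.
Qed.

Lemma dual_mulDl : left_distributive dual_mul dual_add.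
Proof. by move=> D1 D2 D; apply: dualP. Qed.

Lemma dual_mulDr : right_distributive dual_mul dual_add.
Proof.
move=> D D1 D2; apply: dualP => x.
have E t : idtens (dual_add D1 D2) t = idtens D1 t + idtens D2 t.
  elim/rtensor_ind: t => [|b c t IHt]; first by rewrite !raddf0 addr0.
  rewrite !raddfD /= IHt [RHS]addrACA; congr (_ + _).
  by rewrite !idtensE -mulrDr -rmorphD.
have DE t : D (idtens (dual_add D1 D2) t) = D (idtens D1 t) + D (idtens D2 t).
  by rewrite E raddfD.
exact: DE.
Qed.

HB.instance Definition _ := GRing.Zmodule_isPzRing.Build dual
  dual_mulA dual_1mul dual_mul1 dual_mulDl dual_mulDr.

(* Every function out of a discrete space is continuous, so the compact-open
   topology of Hom_{A,etaL}(Gamma, A) is induced from all functions. *)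
HB.instance Definition _ := Topological.copy dual
  (initial_topology (fun D : dual =>
     (D : Gam -> A) :
       {compact-open, discrete_topology Gam -> discrete_topology A})).

End DualRing.

Section EndRing.
Variable M : zmodType.

Definition zend : Type := {additive M -> M}.
HB.instance Definition _ := gen_eqMixin zend.
HB.instance Definition _ := gen_choiceMixin zend.
Implicit Types f g h : zend.

Lemma zendP f g : (forall x, f x = g x) -> f = g.
Proof. exact: additiveP_eq. Qed.

Definition zend_zero : zend := \0 : {additive M -> M}.
Definition zend_one : zend := idfun : {additive M -> M}.
Definition zend_opp f : zend := \- f : {additive M -> M}.
Definition zend_add f g : zend := f \+ g : {additive M -> M}.
Definition zend_mul f g : zend := f \o g : {additive M -> M}.

Lemma zend_addA : associative zend_add.
Proof. by move=> f g h; apply: zendP => x; apply: addrA. Qed.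
Lemma zend_addC : commutative zend_add.
Proof. by move=> f g; apply: zendP => x; apply: addrC. Qed.
Lemma zend_add0 : left_id zend_zero zend_add.
Proof. by move=> f; apply: zendP => x; apply: add0r. Qed.
Lemma zend_addN : left_inverse zend_zero zend_opp zend_add.
Proof. by move=> f; apply: zendP => x; apply: addNr. Qed.
HB.instance Definition _ := GRing.isZmodule.Build zend
  zend_addA zend_addC zend_add0 zend_addN.

Lemma zend_mulA : associative zend_mul.
Proof. by move=> f g h; apply: zendP. Qed.
Lemma zend_1mul : left_id zend_one zend_mul.
Proof. by move=> f; apply: zendP. Qed.
Lemma zend_mul1 : right_id zend_one zend_mul.
Proof. by move=> f; apply: zendP. Qed.
Lemma zend_mulDl : left_distributive zend_mul +%R.
Proof. by move=> f g h; apply: zendP. Qed.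
Lemma zend_mulDr : right_distributive zend_mul +%R.
Proof. by move=> f g h; apply: zendP => x; apply: raddfD. Qed.
HB.instance Definition _ := GRing.Zmodule_isPzRing.Build zend
  zend_mulA zend_1mul zend_mul1 zend_mulDl zend_mulDr.

HB.instance Definition _ := Topological.copy zend
  (initial_topology (fun f : zend =>
     (f : M -> M) :
       {compact-open, discrete_topology M -> discrete_topology M})).

End EndRing.

Record category : Type := Category {
  ob :> Type;
  hom : ob -> ob -> Type;
  idm : forall X, hom X X;
  compm : forall X Y Z, hom Y Z -> hom X Y -> hom X Z;
  compmA : forall X Y Z T (f : hom Z T) (g : hom Y Z) (h : hom X Y),
    compm f (compm g h) = compm (compm f g) h;
  comp1m : forall X Y (f : hom X Y), compm (idm Y) f = f;
  compm1 : forall X Y (f : hom X Y), compm f (idm X) = f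
}.

Arguments hom {c} X Y.
Arguments idm {c} X.
Arguments compm {c X Y Z} f g.

Record functor (C D : category) : Type := Functor {
  fobj :> C -> D;
  fmap : forall X Y, hom X Y -> hom (fobj X) (fobj Y);
  fmap_id : forall X, fmap (idm X) = idm (fobj X);
  fmap_comp : forall X Y Z (f : hom Y Z) (g : hom X Y),
    fmap (compm f g) = compm (fmap f) (fmap g)
}.

Arguments fmap {C D} F {X Y} f : rename.

Definition functor_id (C : category) : functor C C :=
  @Functor C C id (fun X Y f => f) (fun X => erefl) (fun X Y Z f g => erefl).

Section FunctorComp.
Variables (C D E : category) (F : functor D E) (K : functor C D).

Lemma functor_comp_id X : fmap F (fmap K (idm X)) = idm (F (K X)).
Proof. by rewrite !fmap_id. Qed.

Lemma functor_comp_comp X Y Z (f : hom Y Z) (g : hom X Y) :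
  fmap F (fmap K (compm f g)) = compm (fmap F (fmap K f)) (fmap F (fmap K g)).
Proof. by rewrite !fmap_comp. Qed.

Definition functor_comp : functor C E :=
  @Functor C E (fun X => F (K X)) (fun X Y f => fmap F (fmap K f))
    functor_comp_id functor_comp_comp.

End FunctorComp.

Definition is_iso (C : category) (X Y : C) (f : hom X Y) : Prop :=
  exists g : hom Y X, compm g f = idm X /\ compm f g = idm Y.

Definition naturally_isomorphic (C D : category) (F K : functor C D) : Prop :=
  exists eta : forall X : C, hom (F X) (K X),
    (forall (X Y : C) (f : hom X Y),
       compm (eta Y) (fmap F f) = compm (fmap K f) (eta X)) /\
    (forall X, is_iso (eta X)).

Definition is_equivalence (C D : category) (F : functor C D) : Prop :=
  exists K : functor D C,
    naturally_isomorphic (functor_comp K F) (functor_id C) /\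
    naturally_isomorphic (functor_comp F K) (functor_id D).

Section RCoMod.
Variable G : hopf_algebroid.

Lemma comod_homP (M N : rcomod G) (f g : comod_hom M N) :
  (forall m, sval f m = sval g m) -> f = g.
Proof.
move=> fg; have {}fg : sval f = sval g by apply: linearP_eq.
case: f g fg => [f hf] [g hg] /= fg; case: _ / fg in hg *.
by rewrite (Prop_irrelevance hf hg).
Qed.

Lemma comod_id_morphism (M : rcomod G) :
  @comod_morphism G M M (idfun : {linear M -> M}).
Proof. by move=> m; apply: ext_map_id. Qed.

Definition comod_id (M : rcomod G) : comod_hom M M :=
  exist _ _ (@comod_id_morphism M).

Lemma comod_comp_morphism (M N P : rcomod G) (f : comod_hom N P)
    (g : comod_hom M N) :
  @comod_morphism G M P (sval f \o sval g : {linear M -> P}).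
Proof.
by move=> m; rewrite ext_map_comp (svalP g) (svalP f).
Qed.

Definition comod_comp (M N P : rcomod G) (f : comod_hom N P)
    (g : comod_hom M N) : comod_hom M P :=
  exist _ _ (comod_comp_morphism f g).

Definition RCoMod : category.
Proof.
refine (@Category (rcomod G) (@comod_hom G) comod_id comod_comp _ _ _).
- by move=> M N P Q f g h; apply: comod_homP.
- by move=> M N f; apply: comod_homP.
- by move=> M N f; apply: comod_homP.
Defined.

End RCoMod.

Section DiscreteModules.
Variable G : hopf_algebroid.

(* A zmodType stands for a discrete abelian group: the discrete topology only
   enters through the topology of zend. *)
Record dmod : Type := DMod {
  dmod_carrier :> zmodType;
  dact : {rmorphism dual_alg G -> zend dmod_carrier};
  dact_continuous : continuous dact
}.

Definition dmod_morphism (M N : dmod) (f : {additive M -> N}) : Prop :=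
  forall D m, f (dact M D m) = dact N D (f m).

Definition dmod_hom (M N : dmod) : Type :=
  {f : {additive M -> N} | dmod_morphism f}.

Lemma dmod_homP (M N : dmod) (f g : dmod_hom M N) :
  (forall m, sval f m = sval g m) -> f = g.
Proof.
move=> fg; have {}fg : sval f = sval g by apply: additiveP_eq.
case: f g fg => [f hf] [g hg] /= fg; case: _ / fg in hg *.
by rewrite (Prop_irrelevance hf hg).
Qed.

Lemma dmod_id_morphism (M : dmod) :
  @dmod_morphism M M (idfun : {additive M -> M}).
Proof. by []. Qed.

Definition dmod_id (M : dmod) : dmod_hom M M :=
  exist _ _ (@dmod_id_morphism M).

Lemma dmod_comp_morphism (M N P : dmod) (f : dmod_hom N P)
    (g : dmod_hom M N) :
  @dmod_morphism M P (sval f \o sval g : {additive M -> P}).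
Proof. by move=> D m; rewrite /= (svalP g) (svalP f). Qed.

Definition dmod_comp (M N P : dmod) (f : dmod_hom N P) (g : dmod_hom M N) :
  dmod_hom M P := exist _ _ (dmod_comp_morphism f g).

Definition DiscMod : category.
Proof.
refine (@Category dmod dmod_hom dmod_id dmod_comp _ _ _).
- by move=> M N P Q f g h; apply: dmod_homP.
- by move=> M N f; apply: dmod_homP.
- by move=> M N f; apply: dmod_homP.
Defined.

End DiscreteModules.

Section ComoduleFunctor.
Local Open Scope classical_set_scope.
Variable G : hopf_algebroid.
Local Notation A := (base G).
Local Notation Gam := (total G).
Local Notation eL := (etaL G).
Local Notation dual := (dual_alg G).

Section Action.
Variable M : rcomod G.

Definition comod_act_fun (D : dual) (m : M) : M := id_dual D (coact M m).

Lemma comod_act_zmod D : zmod_morphism (comod_act_fun D).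
Proof. by move=> m n; rewrite /comod_act_fun [coact M _]raddfB; apply: raddfB. Qed.
HB.instance Definition _ D :=
  GRing.isZmodMorphism.Build M M (comod_act_fun D) (comod_act_zmod D).

Definition comod_act (D : dual) : zend M :=
  comod_act_fun D : {additive M -> M}.

Lemma comod_act_add : zmod_morphism comod_act.
Proof.
move=> D1 D2; apply: zendP => m.
have E (t : ext eL M) : id_dual (D1 - D2) t = id_dual D1 t - id_dual D2 t.
  elim/ext_ind: t => [|n x t IHt]; first by rewrite 3!raddf0 subr0.
  rewrite !raddfD /= IHt [RHS]addrACA; congr (_ + _).
  by rewrite !id_dualE -scalerBl.
exact: E.
Qed.
HB.instance Definition _ :=
  GRing.isZmodMorphism.Build dual (zend M) comod_act comod_act_add.

Lemma comod_act_mul : monoid_morphism comod_act.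
Proof.
split=> [|D2 D1]; apply: zendP => m; first exact: coact1.
exact/id_dual_mul/coactA.
Qed.
HB.instance Definition _ :=
  GRing.isMonoidMorphism.Build dual (zend M) comod_act comod_act_mul.

Lemma dual_near_eq (D : dual) (x : Gam) : nbhs D [set D' : dual | D' x = D x].
Proof.
have /continuousP c := @initial_continuous dual
  {compact-open, discrete_topology Gam -> discrete_topology A}
  (fun D : dual => (D : Gam -> A) :
    {compact-open, discrete_topology Gam -> discrete_topology A}).
have o : open [set f : {compact-open, discrete_topology Gam ->
    discrete_topology A} | f @` [set x] `<=` [set D x]].
  by apply: compact_open_open; [apply: compact_set1|apply: discrete_open].
have /= := c _ o; rewrite openE => /(_ D).
move=> H; apply: filterS (H _) => [D' /=|_ [_ -> <-]//].
by apply; exists x.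
Qed.

Lemma comod_act_near (D : dual) (m : M) :
  nbhs D [set D' : dual | comod_act_fun D' m = comod_act_fun D m].
Proof.
have E (t : ext eL M) : nbhs D [set D' : dual | id_dual D' t = id_dual D t].
  elim/ext_ind: t => [|n x t IHt].
    by apply: filterE => D' /=; rewrite !raddf0.
  apply: filterS2 IHt (dual_near_eq D x) => D' /= Et Ex.
  by rewrite !raddfD /= Et !id_dualE Ex.
exact: E.
Qed.

Lemma comod_act_continuous : continuous comod_act.
Proof.
apply: continuous_comp_initial => D.
have FD : Filter (nbhs D) := nbhs_filter D.
apply: (iffRL (@compact_open_cvgP _ _ _ _ (fmap_filter _ FD))).
move=> K O cK oO DKO.
have /compact_near_coveringP/(_ _ _ (fun D' m => O (comod_act D' m))) := cK.
move=> /(_ _ FD) cover; have {cover} : \forall D' \near D,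
    K `<=` (fun m => O (comod_act D' m)).
  apply: cover => m Km.
  exists ([set m], [set D' : dual | comod_act_fun D' m = comod_act_fun D m]).
    by split; [exact: discrete_set1|exact: comod_act_near].
  by move=> [_ D'] /= [-> E]; rewrite [comod_act D' m]E; apply: DKO; exists m.
by apply: filterS => D' KO _ [m Km <-]; apply: KO.
Qed.

Definition comod_dmod : dmod G :=
  @DMod G M (comod_act : {rmorphism dual -> zend M}) comod_act_continuous.

End Action.

Lemma comod_dmod_morphism (M N : rcomod G) (f : comod_hom M N) :
  @dmod_morphism G (comod_dmod M) (comod_dmod N) (sval f : {additive M -> N}).
Proof.
move=> D m; have E (t : ext eL M) :
    sval f (id_dual D t) = id_dual D (ext_map eL (sval f) t).
  elim/ext_ind: t => [|n x t IHt]; first by rewrite !raddf0.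
  by rewrite !raddfD /= IHt ext_mapE !id_dualE linearZ.
exact: etrans (E _) (congr1 (id_dual D) (svalP f m)).
Qed.

Definition comod_dmod_hom (M N : rcomod G) (f : comod_hom M N) :
  dmod_hom (comod_dmod M) (comod_dmod N) := exist _ _ (comod_dmod_morphism f).

(* (M, psi) is sent to M with D acting as (id_M (x) D) psi, and a comodule
   morphism to its underlying additive map *)
Definition comod_functor : functor (RCoMod G) (DiscMod G).
Proof.
refine (@Functor (RCoMod G) (DiscMod G) comod_dmod comod_dmod_hom _ _).
- by move=> M; apply: dmod_homP.
- by move=> M N P f g; apply: dmod_homP.
Defined.

End ComoduleFunctor.

Section Basis.
Local Open Scope classical_set_scope.
Variables (A : pzRingType) (V : lmodType A).

Definition is_basis (B : set V) : Prop :=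
  (forall (s : seq V) (c : V -> A), uniq s -> (forall x, x \in s -> B x) ->
     \sum_(x <- s) c x *: x = 0 -> forall x, x \in s -> c x = 0) /\
  (forall v, exists (s : seq V) (c : V -> A),
     (forall x, x \in s -> B x) /\ v = \sum_(x <- s) c x *: x).

(* countable allows finite bases *)
Definition free_with_countable_basis : Prop :=
  exists B : set V, countable B /\ is_basis B.

End Basis.

(* Main.v *)
(* On M (x) Gamma a functional D acts by id (x) D and, since Gamma has a basis
   over A, these maps jointly separate points.  Hence every identity between
   comodule structure maps can be tested on functionals; in particular an
   additive map commuting with all functionals is a comodule morphism, being
   A-linear because a in A acts as the functional a * epsilon.  Conversely,
   continuity of an action on a discrete M means that D m depends only on
   finitely many values of D, so all but finitely many coordinate functionals
   b^* kill m, and psi(m) = sum_b b^*(m) (x) b is a finite sum with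
   (id (x) D) psi(m) = D m. *)
From HB Require Import structures.
From mathcomp Require Import all_boot all_algebra.
From mathcomp Require Import boolp classical_sets topology.
Require Import Defs.

Set Implicit Arguments.
Unset Strict Implicit.
Unset Printing Implicit Defensive.

Import GRing.Theory.

Local Open Scope ring_scope.
Local Open Scope hopf_scope.

(** * Criterion for an equivalence of categories *)

(** The inverse functor chooses for each [Y] an object with an isomorphism [e Y] onto [Y], and sends
    [g] to a preimage of its conjugate by these. Faithfulness reduces its functoriality, and the
    naturality of the unit, to identities after applying [F]. *)
Lemma fully_faithful_equivalence (C D : category) (F : functor C D) :
  (forall (X Y : C) (f g : hom X Y), fmap F f = fmap F g -> f = g) ->
  (forall (X Y : C) (g : hom (F X) (F Y)), exists f, fmap F f = g) ->
  (forall Y : D, exists X (e : hom (F X) Y), is_iso e) ->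
  is_equivalence F.
Proof.
move=> faithF fullF essF.
pose K0 Y := sval (cid (essF Y)); pose e Y := sval (cid (svalP (cid (essF Y)))).
have eP Y : is_iso (e Y) := svalP (cid (svalP (cid (essF Y)))).
pose e' Y := sval (cid (eP Y)).
have eK Y : compm (e' Y) (e Y) = idm (F (K0 Y)) := proj1 (svalP (cid (eP Y))).
have e'K Y : compm (e Y) (e' Y) = idm Y := proj2 (svalP (cid (eP Y))).
pose lft X Y (g : hom (F X) (F Y)) := sval (cid (fullF X Y g)).
have lftE X Y g : fmap F (@lft X Y g) = g := svalP (cid (fullF X Y g)).
pose K1 X Y (g : hom X Y) : hom (K0 X) (K0 Y) :=
  lft _ _ (compm (e' Y) (compm g (e X))).
have K1_id Y : K1 _ _ (idm Y) = idm (K0 Y).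
  by apply: faithF; rewrite lftE fmap_id comp1m eK.
have K1_comp X Y Z (f : hom Y Z) (g : hom X Y) :
    K1 _ _ (compm f g) = compm (K1 _ _ f) (K1 _ _ g).
  apply: faithF; rewrite fmap_comp !lftE -!compmA; congr compm; congr compm.
  by rewrite [RHS]compmA e'K comp1m.
pose K := @Functor D C K0 K1 K1_id K1_comp.
exists K; split.
- exists (fun X => lft (K0 (F X)) X (e (F X))); split=> [X Y f|X].
    apply: faithF; rewrite !fmap_comp /= !lftE.
    by rewrite !compmA e'K comp1m.
  exists (lft X (K0 (F X)) (e' (F X))).
  by split; apply: faithF; rewrite fmap_comp !lftE fmap_id ?eK ?e'K.
- exists e; split=> [X Y f|X]; last exact: eP.
  by rewrite /= lftE !compmA e'K comp1m.
Qed.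

(** * Dual basis of a free module *)

Lemma sum_support_widen (I : eqType) (U : zmodType) (f : I -> U)
    (s s' : seq I) :
  uniq s -> uniq s' -> {subset s <= s'} -> (forall x, x \notin s -> f x = 0) ->
  \sum_(x <- s') f x = \sum_(x <- s) f x.
Proof.
move=> us us' ss' f0.
have -> : \sum_(x <- s) f x = \sum_(x <- s' | x \in s) f x.
  rewrite -[RHS]big_filter; apply: perm_big; apply: uniq_perm => //.
    exact: filter_uniq.
  by move=> x; rewrite mem_filter; case: (boolP (x \in s)) => // /ss' ->.
rewrite [RHS]big_mkcond; apply: eq_bigr => x _.
by case: ifPn => // /f0.
Qed.

Section DualBasis.
Local Open Scope classical_set_scope.
Variables (A : pzRingType) (V : lmodType A) (B : set V).
Hypothesis basisB : is_basis B.

Lemma basis_coordinates v : exists c : V -> A, exists s : seq V,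
  [/\ uniq s, forall x, x \in s -> B x, forall x, x \notin s -> c x = 0
    & v = \sum_(x <- s) c x *: x].
Proof.
have [_ /(_ v)[s [c [sB ->]]]] := basisB.
(* The spanning list may repeat a vector: its multiplicity goes into the coefficient, which thereby
   vanishes off the list. *)
exists (fun x => c x *+ count_mem x s), (undup s); split.
- exact: undup_uniq.
- by move=> x; rewrite mem_undup; apply: sB.
- by move=> x; rewrite mem_undup => /count_memPn->.
rewrite -big_undup_iterop_count; apply: eq_bigr => x _.
by rewrite -scalerMnl.
Qed.

Lemma coordinates_unique (c c' : V -> A) (s : seq V) :
  uniq s -> (forall x, x \in s -> B x) ->
  \sum_(x <- s) c x *: x = \sum_(x <- s) c' x *: x ->
  forall x, x \in s -> c x = c' x.
Proof.
move=> us sB /eqP; rewrite -subr_eq0 -sumrB => /eqP E x xs; apply/eqP.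
rewrite -subr_eq0; apply/eqP.
apply: (proj1 basisB s (fun x => c x - c' x)) => //.
by rewrite -[RHS]E; apply: eq_bigr => y _; rewrite scalerBl.
Qed.

(* The expansion is stated for all large finite s' so that expansions of
   several elements can share one index set. *)
Lemma dual_basis : exists coord : V -> {scalar V},
  forall v, exists s : seq V, forall s', uniq s' -> {subset s <= s'} ->
    v = \sum_(x <- s') coord x v *: x.
Proof.
have [c cP] := choice basis_coordinates.
have c_scalar x : scalar (c^~ x).
  move=> a v w; have [su [uu uB u0 eu]] := cP (a *: v + w).
  have [sv [uv vB v0 ev]] := cP v; have [sw [uw wB w0 ew]] := cP w.
  (* Over this common list the coefficients of the three vectors can be compared by uniqueness; off
     it all three vanish. *)
  pose s := undup (su ++ sv ++ sw).
  have us : uniq s by apply: undup_uniq.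
  have sB y : y \in s -> B y.
    by rewrite mem_undup !mem_cat => /or3P[/uB|/vB|/wB].
  have widen s1 (d : V -> A) : {subset s1 <= s} -> uniq s1 ->
      (forall y, y \notin s1 -> d y = 0) ->
      \sum_(y <- s1) d y *: y = \sum_(y <- s) d y *: y.
    move=> s1s u1 d0; apply/esym/sum_support_widen => // y /d0 ->.
    exact: scale0r.
  have [xs|] := boolP (x \in s); last first.
    rewrite mem_undup !mem_cat !negb_or => /and3P[xu xv xw].
    by rewrite u0 // v0 // w0 // mulr0 addr0.
  apply: (coordinates_unique (c' := fun x => a * c v x + c w x) us sB _ xs).
  have sum_u : a *: v + w = \sum_(y <- s) c (a *: v + w) y *: y.
    by rewrite {1}eu; apply: widen => // y; rewrite mem_undup mem_cat => ->.
  have sum_v : v = \sum_(y <- s) c v y *: y.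
    rewrite {1}ev; apply: widen => // y.
    by rewrite mem_undup !mem_cat orbCA => ->.
  have sum_w : w = \sum_(y <- s) c w y *: y.
    rewrite {1}ew; apply: widen => // y.
    by rewrite mem_undup !mem_cat orbA orbC => ->.
  rewrite -sum_u {1}sum_v {1}sum_w scaler_sumr -big_split.
  by apply: eq_bigr => y _; rewrite scalerDl scalerA.
pose coord x : {scalar V} :=
  HB.pack (c^~ x) (GRing.isLinear.Build A V A *%R (c^~ x) (c_scalar x)).
exists coord => v; have [s [us _ c0 ev]] := cP v; exists s => s' us' ss'.
rewrite (sum_support_widen us us' ss') // => x xs.
by rewrite /coord /= c0 // scale0r.
Qed.

End DualBasis.

(** * Neighbourhoods in the compact-open topologies *)

Section DualTopology.
Local Open Scope classical_set_scope.

(** The sets containing every function that agrees with [f] on some finite list form a filter [F].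
    It converges to [f]: each condition at a single point holds eventually along [F], and
    compactness of [K] makes this uniform on [K]. *)
Lemma compact_open_discrete_nbhs (X Y : choiceType)
    (f : {compact-open, discrete_topology X -> discrete_topology Y})
    (U : set {compact-open, discrete_topology X -> discrete_topology Y}) :
  nbhs f U ->
  exists s : seq X, forall g : X -> Y, (forall x, x \in s -> g x = f x) -> U g.
Proof.
pose agree (s : seq X) : set (X -> Y) :=
  [set g | forall x, x \in s -> g x = f x].
pose F : set_system {compact-open, discrete_topology X -> discrete_topology Y}
  := [set P | exists s, agree s `<=` P].
have FF : Filter F.
  split=> [|P Q [s sP] [t tQ]|P Q PQ [s sP]].
  - by exists [::].
  - exists (s ++ t) => g st; split.
      by apply: sP => x xs; apply: st; rewrite mem_cat xs.
    by apply: tQ => x xt; apply: st; rewrite mem_cat xt orbT.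
  - by exists s => g /sP /PQ.
suff cF : F --> f by move=> /cF[s sU]; exists s.
apply/compact_open_cvgP => K O cK oO fKO.
have /compact_near_coveringP/(_ _ F (fun g x => O (g x)) FF) := cK.
have nearF x : K x -> \forall x' \near x & g \near F, O (g x').
  move=> Kx; exists ([set x], [set g | g x = f x]).
    split; first exact: discrete_set1.
    by exists [:: x] => g /=; apply; rewrite inE.
  by move=> [_ g] /= [-> ->]; apply: fKO; exists x.
move=> /(_ nearF) near.
by apply: filterS near => g gKO _ [x Kx <-]; apply: gKO.
Qed.

Variable G : hopf_algebroid.
Implicit Types D : dual_alg G.

Lemma dual_nbhs D (U : set (dual_alg G)) : nbhs D U ->
  exists s : seq (total G), forall D',
    (forall x, x \in s -> D' x = D x) -> U D'.
Proof.
rewrite nbhsE => -[V [[O oO <-] /= OD] VU].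
have [s sO] := compact_open_discrete_nbhs (open_nbhs_nbhs (conj oO OD)).
by exists s => D' D's; apply: VU; apply: sO.
Qed.

Lemma zend_near_eq (M : zmodType) (f : zend M) (m : M) :
  nbhs f [set g : zend M | g m = f m].
Proof.
pose O : set {compact-open, discrete_topology M -> discrete_topology M} :=
  [set h | h @` [set m] `<=` [set f m]].
have oO : open O.
  by apply: compact_open_open; [apply: compact_set1|apply: discrete_open].
have O_f : O f by move=> _ [_ -> <-].
rewrite nbhsE; exists [set g : zend M | O (g : M -> M)].
  by split=> //; exists O.
by move=> g; apply; exists m.
Qed.

(** Continuity at [0] suffices: it yields a finite list such that a functional vanishing on it kills
    [m], and this applies to every difference [D - D']. *)
Lemma dact_near_eq (N : dmod G) (m : N) :
  exists s : seq (total G), forall D D',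
    (forall x, x \in s -> D x = D' x) -> dact N D m = dact N D' m.
Proof.
have [s sP] := dual_nbhs
  (dact_continuous (x := 0) (zend_near_eq (dact N 0) m)).
exists s => D D' DD'; apply/eqP; rewrite -subr_eq0.
have /sP : forall x, x \in s -> (D - D' : dual_alg G) x = (0 : dual_alg G) x.
  by move=> x xs; rewrite [LHS](_ : _ = D x - D' x) // DD' // subrr.
by rewrite /= !raddf0 raddfB => /eqP.
Qed.

End DualTopology.

(** * Evaluating functionals on tensor products *)

Section ExtPure.
Variables (A B : comPzRingType) (f : {rmorphism A -> B}) (M : lmodType A).

Lemma ext_pure_zmodr (m : M) : zmod_morphism (ext_pure f m).
Proof.
have [_ pDr _] := ext_pure_balanced f M.
by move=> x y; apply: (addIr (ext_pure f m y)); rewrite -pDr !subrK.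
Qed.
HB.instance Definition _ m :=
  GRing.isZmodMorphism.Build B (ext f M) (ext_pure f m) (ext_pure_zmodr m).

Lemma ext_pure0l x : ext_pure f (0 : M) x = 0.
Proof.
have [pDl _ _] := ext_pure_balanced f M.
by apply: (addrI (ext_pure f 0 x)); rewrite -pDl !addr0.
Qed.

End ExtPure.

Section HopfDual.
Variable G : hopf_algebroid.
Local Notation A := (base G).
Local Notation Gam := (total G).
Local Notation eL := (etaL G).
Local Notation eR := (etaR G).
Local Notation dual := (dual_alg G).
Implicit Types (D : dual) (a : A).

(* The base ring acts on a discrete module through these functionals. *)
Definition dual_base_fun a (x : rmod eL) : A := a * counit G x.
Lemma dual_base_scalar a : scalar (dual_base_fun a).
Proof.
move=> b x y; rewrite /dual_base_fun rmodZ rmorphD rmorphM counit_etaL mulrDr.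
by rewrite mulrCA.
Qed.
HB.instance Definition _ a := GRing.isLinear.Build A (rmod eL) A *%R
  (dual_base_fun a) (dual_base_scalar a).
Definition dual_base a : dual := dual_base_fun a : {scalar rmod eL}.

Lemma dual_base_mul a D x : (dual_base a * D) x = a * D x.
Proof. by rewrite -[in RHS](mul1r D). Qed.

(** [comul_etaR] places [eR a] in the right factor, where [dual_base a] sees it through the counit;
    hence right multiplication involves the right unit. *)
Lemma dual_mul_base a D x : (D * dual_base a) x = D (eR a * x).
Proof.
rewrite -[in RHS](mulr1 D); congr (D _).
rewrite rmorphM comul_etaR.
elim/rtensor_ind: (comul G x) => [|b c t IHt]; first by rewrite mulr0 !raddf0.
rewrite mulrDr !raddfD /= IHt; congr (_ + _).
rewrite [_ * _]rpureM mul1r !idtensE /= /dual_base_fun /counit_mod !rmorphM.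
by rewrite counit_etaR.
Qed.

Lemma dual_base_zmod : zmod_morphism dual_base.
Proof. by move=> a b; apply: dualP => x; apply: mulrBl. Qed.
HB.instance Definition _ :=
  GRing.isZmodMorphism.Build A dual dual_base dual_base_zmod.

Lemma dual_base_monoid : monoid_morphism dual_base.
Proof.
split=> [|a b]; apply: dualP => x; first exact: mul1r.
by rewrite dual_base_mul /= /dual_base_fun mulrA.
Qed.
HB.instance Definition _ :=
  GRing.isMonoidMorphism.Build A dual dual_base dual_base_monoid.

Lemma dual_sumE (I : Type) (s : seq I) (F : I -> dual) x :
  (\sum_(i <- s) F i) x = \sum_(i <- s) F i x.
Proof. by elim/big_rec2: _ => // i y E _ <-. Qed.

Lemma id_dual_ext_map (M N : lmodType A) (f : {linear M -> N}) D t :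
  id_dual D (ext_map eL f t) = f (id_dual D t).
Proof.
elim/ext_ind: t => [|m x t IHt]; first by rewrite !raddf0.
by rewrite !raddfD /= IHt ext_mapE !id_dualE linearZ.
Qed.

Lemma id_dual_scale (M : lmodType A) D a (t : ext eL M) :
  id_dual D (eR a *: t) = id_dual (D * dual_base a) t.
Proof.
elim/ext_ind: t => [|m x t IHt]; first by rewrite scaler0 !raddf0.
rewrite scalerDr !raddfD /= IHt scale_ext_pure !id_dualE; congr (_ + _).
by congr (_ *: m); rewrite dual_mul_base.
Qed.

Section Assoc.
Variable M : lmodType A.

Lemma id_dual2_balanced D2 D1 : @balanced _ M (rmod (eLL G)) M
  (fun m t => D2 (idtens D1 t) *: m).
Proof.
split=> [m1 m2 t|m1 t t'|a m1 t].
- exact: scalerDr.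
- by rewrite !raddfD scalerDl.
- by rewrite rmodZ idtens_rinl dualZ scalerA mulrC.
Qed.

(** Both sides of coassociativity lie in the source of this map. On [id_comul] it evaluates at the
    product [D2 * D1], on [ext_assoc] at [D1] and then at [D2]. *)
Definition id_dual2 D2 D1 : ext (eLL G) M -> M :=
  tlift (id_dual2_balanced D2 D1).
HB.instance Definition _ D2 D1 := GRing.Additive.copy (id_dual2 D2 D1)
  (tlift (id_dual2_balanced D2 D1)).

Lemma id_dual2E D2 D1 m t :
  id_dual2 D2 D1 (ext_pure (eLL G) m t) = D2 (idtens D1 t) *: m.
Proof. exact: tliftE. Qed.

Lemma id_dual2_comul D2 D1 t :
  id_dual2 D2 D1 (id_comul t) = id_dual (D2 * D1) t.
Proof.
elim/ext_ind: t => [|m x t IHt]; first by rewrite !raddf0.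
by rewrite !raddfD /= IHt id_comulE id_dual2E id_dualE.
Qed.

Lemma id_dual2_assoc D2 D1 (t : ext eL (pullback (ext eL M) eR)) :
  id_dual2 D2 D1 (ext_assoc t) = id_dual D2 (id_dual D1 t).
Proof.
elim/ext_ind: t => [|u x t IHt]; first by rewrite !raddf0.
rewrite !raddfD /= IHt; congr (_ + _); rewrite ext_assocE1 id_dualE.
elim/ext_ind: u => [|m y u IHu]; first by rewrite scaler0 !raddf0.
rewrite scalerDr !raddfD /= IHu; congr (_ + _).
rewrite pullbackZ scale_ext_pure ext_assoc1E id_dual2E id_dualE.
by rewrite idtensE mulrC.
Qed.

(** This lifts an element to the iterated extension, where functionals can be applied to one factor
    of [Gam] at a time. *)
Lemma ext_assoc_surj (t : ext (eLL G) M) :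
  exists u : ext eL (pullback (ext eL M) eR), ext_assoc u = t.
Proof.
elim/ext_ind: t => [|m g t [u <-]]; first by exists 0; rewrite raddf0.
suff [v <-] : exists v : ext eL (pullback (ext eL M) eR),
    ext_assoc v = ext_pure (eLL G) m g by exists (v + u); rewrite raddfD.
elim/rtensor_ind: g => [|x y g [v IHv]]; first by exists 0; rewrite !raddf0.
exists (ext_pure eL (ext_pure eL m x : pullback (ext eL M) eR) y + v).
by rewrite !raddfD /= IHv ext_assocE.
Qed.

End Assoc.

(** * Separation by functionals and fullness *)

Section Free.
Hypothesis free : free_with_countable_basis (rmod eL).

(** For a pure tensor, balancing carries the coefficients [coord y x] into the right factor, where
    they reassemble [x]; sums are handled by concatenating index lists. *)
Lemma ext_expand : exists coord : Gam -> dual,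
  (forall x, exists s : seq Gam, forall s', uniq s' -> {subset s <= s'} ->
     x = \sum_(y <- s') eL (coord y x) * y) /\
  (forall (M : lmodType A) (t : ext eL M), exists s : seq Gam, forall s',
     uniq s' -> {subset s <= s'} ->
     t = \sum_(y <- s') ext_pure eL (id_dual (coord y) t) y).
Proof.
have [B [_ basisB]] := free; have [coord coordP] := dual_basis basisB.
exists coord; split=> // M t.
elim/ext_ind: t => [|m x t [s sP]].
  by exists [::] => s' _ _; rewrite big1 // => y _; rewrite raddf0 ext_pure0l.
have [s1 s1P] := coordP x.
exists (s1 ++ s) => s' us' ss'.
have s1s' : {subset s1 <= s'} by move=> y ys; rewrite ss' // mem_cat ys.
have ss : {subset s <= s'} by move=> y ys; rewrite ss' // mem_cat ys orbT.
under eq_bigr do rewrite raddfD /= id_dualE.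
have [pDl _ pZ] := ext_pure_balanced eL M.
under eq_bigr do rewrite pDl pZ.
rewrite big_split /= -(sP _ us' ss) {1}(s1P _ us' s1s'); congr (_ + _).
exact: raddf_sum.
Qed.

Lemma id_dual_inj (M : lmodType A) (t u : ext eL M) :
  (forall D, id_dual D t = id_dual D u) -> t = u.
Proof.
move=> tu; have [coord [_ expand]] := ext_expand.
have [[s sP] [s' s'P]] := (expand M t, expand M u).
rewrite (sP (undup (s ++ s'))) ?undup_uniq // => [|x]; last first.
  by rewrite mem_undup mem_cat => ->.
rewrite [RHS](s'P (undup (s ++ s'))) ?undup_uniq // => [|x]; last first.
  by rewrite mem_undup mem_cat orbC => ->.
by apply: eq_bigr => x _; rewrite tu.
Qed.

Lemma comod_dmod_full (M N : rcomod G)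
    (f : dmod_hom (comod_dmod M) (comod_dmod N)) :
  exists g : comod_hom M N, comod_dmod_hom g = f.
Proof.
(* By counitarity, scalars are recovered from the action of functionals. *)
have base_act (P : rcomod G) a (m : P) :
    dact (comod_dmod P) (dual_base a) m = a *: m.
  rewrite -[in RHS](coact1 m) /= /comod_act_fun.
  elim/ext_ind: (coact P m) => [|n x t IHt]; first by rewrite !raddf0.
  by rewrite !raddfD /= IHt !id_dualE scalerA.
have f_lin : linear (sval f).
  by move=> a m n; rewrite raddfD -!base_act (svalP f).
pose g : {linear M -> N} :=
  HB.pack (sval f : M -> N) (GRing.isLinear.Build A M N *:%R (sval f) f_lin).
have g_mor : comod_morphism g.
  move=> m; apply: id_dual_inj => D.
  by rewrite id_dual_ext_map; apply: (svalP f D m).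
by exists (exist _ g g_mor); apply: dmod_homP.
Qed.

(** * The comodule attached to a discrete module *)

Section Comodule.
Variable N : dmod G.

(** A separate name for the carrier, to hold the [A]-module structure coming from [dual_base]. *)
Definition dmod_lmod : Type := N.
HB.instance Definition _ := GRing.Zmodule.on dmod_lmod.

Definition dmod_scale a (m : dmod_lmod) : dmod_lmod := dact N (dual_base a) m.

Lemma dmod_scaleA a b m :
  dmod_scale a (dmod_scale b m) = dmod_scale (a * b) m.
Proof. by rewrite /dmod_scale !rmorphM. Qed.
Lemma dmod_scale1 : left_id 1 dmod_scale.
Proof. by move=> m; rewrite /dmod_scale !rmorph1. Qed.
Lemma dmod_scaleDr : right_distributive dmod_scale +%R.
Proof. by move=> a m n; apply: raddfD. Qed.
Lemma dmod_scaleDl m : {morph dmod_scale^~ m : a b / a + b}.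
Proof. by move=> a b; rewrite /dmod_scale !raddfD. Qed.
HB.instance Definition _ := GRing.Zmodule_isLmodule.Build A dmod_lmod
  dmod_scaleA dmod_scale1 dmod_scaleDr dmod_scaleDl.

Lemma dact_sum (I : Type) (s : seq I) (F : I -> dual) m :
  dact N (\sum_(i <- s) F i) m = \sum_(i <- s) dact N (F i) m.
Proof. by rewrite raddf_sum; elim/big_rec2: _ => // i y E _ <-. Qed.

Lemma dact_represented (m : N) : exists t : ext eL dmod_lmod,
  forall D, id_dual D t = dact N D m.
Proof.
have [coord [expand _]] := ext_expand.
have [F FP] := dact_near_eq m.
have [s sP] : exists s : seq Gam, forall s', uniq s' -> {subset s <= s'} ->
    forall x, x \in F -> x = \sum_(y <- s') eL (coord y x) * y.
  elim: F {FP} => [|x F [s sP]]; first by exists [::].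
  have [s1 s1P] := expand x; exists (s1 ++ s) => s' us' ss' y.
  rewrite inE => /predU1P[->|yF].
    by apply: s1P => // z zs; rewrite ss' // mem_cat zs.
  by apply: sP => // z zs; rewrite ss' // mem_cat zs orbT.
have {}sP := sP _ (undup_uniq s) (fun x => etrans (mem_undup s x)).
exists (\sum_(y <- undup s) ext_pure eL (dact N (coord y) m : dmod_lmod) y).
move=> D.
(* On [F], [D] agrees with the finite combination of the [coord y] with coefficients [D y], so both
   act alike on [m]. *)
rewrite raddf_sum (FP D (\sum_(y <- undup s) dual_base (D y) * coord y)).
  rewrite dact_sum; apply: eq_bigr => y _.
  by rewrite /= id_dualE rmorphM.
move=> x xF; rewrite {1}(sP x xF) dual_sumE [LHS]raddf_sum.
by apply: eq_bigr => y _; rewrite dual_base_mul /= dualZ mulrC.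
Qed.

(** The chosen tensor is unique by [id_dual_inj], so [id_dual_coact] determines this map
    completely. *)
Definition dmod_coact (m : dmod_lmod) : pullback (ext eL dmod_lmod) eR :=
  sval (cid (dact_represented m)).

Lemma id_dual_coact D m : id_dual D (dmod_coact m) = dact N D m.
Proof. exact: (svalP (cid (dact_represented m))). Qed.

(** Scaling in the target goes through [eR]; [id_dual_scale] turns it into right multiplication by
    [dual_base a], which acts on [m] as [D] acts on [a *: m]. *)
Lemma dmod_coact_linear : linear dmod_coact.
Proof.
move=> a m n; apply: id_dual_inj => D.
rewrite id_dual_coact [RHS]raddfD /= id_dual_coact pullbackZ id_dual_scale.
by rewrite id_dual_coact raddfD rmorphM.
Qed.
HB.instance Definition _ := GRing.isLinear.Build A dmod_lmod
  (pullback (ext eL dmod_lmod) eR) *:%R dmod_coact dmod_coact_linear.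

Lemma dmod_coactA : @coassociative G dmod_lmod dmod_coact.
Proof.
move=> m; have [u uE] := ext_assoc_surj (id_comul (dmod_coact m)).
rewrite -uE; congr ext_assoc.
(* Both sides are compared in (M (x) Gamma) (x) Gamma, one factor at a time. *)
apply: id_dual_inj => D1; apply: id_dual_inj => D2.
rewrite -id_dual2_assoc uE id_dual2_comul id_dual_ext_map !id_dual_coact.
by rewrite rmorphM.
Qed.

Lemma dmod_coact1 : @counitary G dmod_lmod dmod_coact.
Proof. by move=> m; rewrite id_dual_coact [dact N _]rmorph1. Qed.

Definition dmod_comod : rcomod G := RComod dmod_coactA dmod_coact1.

(** The underlying groups coincide and [id_dual_coact] matches the actions, so the identity map
    works in both directions. *)
Lemma dmod_comod_iso :
  exists e : @hom (DiscMod G) (comod_dmod dmod_comod) N, is_iso e.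
Proof.
have e_mor : @dmod_morphism G (comod_dmod dmod_comod) N
    (idfun : {additive N -> N}).
  by move=> D m; apply: id_dual_coact.
have e'_mor : @dmod_morphism G N (comod_dmod dmod_comod)
    (idfun : {additive N -> N}).
  by move=> D m; apply/esym/id_dual_coact.
by exists (exist _ _ e_mor), (exist _ _ e'_mor); split; apply: dmod_homP.
Qed.

End Comodule.
End Free.
End HopfDual.

Theorem theorem1p18 (G : hopf_algebroid)
    (free_total : free_with_countable_basis (rmod (etaL G))) :
  is_equivalence (comod_functor G).
Proof.
apply: fully_faithful_equivalence => [M N f g fg|M N f|N].
- apply: comod_homP => m.
  have /(congr1 (fun h : dmod_hom (comod_dmod M) (comod_dmod N) => sval h m)) :
    comod_dmod_hom f = comod_dmod_hom g := fg.
  exact.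
- exact: comod_dmod_full.
- exact: (ex_intro _ _ (dmod_comod_iso free_total N)).
Qed.
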